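(* Let $A=[a_{ij}]$ be an $n\times n$ stochastic matrix ($n\ge2$) and $B$ an $m\times m$ stochastic matrix, such that $P=A\otimes B$ is irreducible, and let $\mathbf{x}=(x_i)$ and $\mathbf{y}$ be the stationary distribution vectors of $A$ and $B$, respectively. Partition $$P=\begin{bmatrix}P_{11}&P_{12}\\P_{21}&P_{22}\end{bmatrix}$$ with $P_{11}=a_{11}B$ of size $m\times m$ (so that $P_{12}=[a_{12}B\ \cdots\ a_{1n}B]$, $P_{21}$ is the block column with blocks $a_{21}B,\dots,a_{n1}B$, and $P_{22}=[a_{ij}]_{i,j=2}^n\otimes B$). Let $P_1=P_{11}+P_{12}(I-P_{22})^{-1}P_{21}$ and $P_2=P_{22}+P_{21}(I-P_{11})^{-1}P_{12}$. Then $$\kappa(P)=\kappa(P_1)+\kappa(P_2)+\frac{1}{1-x_1}\left(\mathbf{e}_1^T(I-A+\mathbf{1}\mathbf{x}^T)^{-1}\mathbf{e}_1-x_1\right).$$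
   Context: A square nonnegative matrix $P$ is stochastic if $P\mathbf{1}=\mathbf{1}$, where $\mathbf{1}$ is the all-ones vector of appropriate size. The stationary distribution vector of an irreducible stochastic $P$ is the unique vector $\boldsymbol{\pi}$ with $\boldsymbol{\pi}^TP=\boldsymbol{\pi}^T$, $\boldsymbol{\pi}^T\mathbf{1}=1$. $\otimes$ is the Kronecker product, and $\mathbf{e}_1$ is the first standard basis vector. $P_1,P_2$ (the stochastic complements of $P_{11}$ and $P_{22}$ in $P$) are stochastic and irreducible. Irreducibility of $A\otimes B$ forces $A$ and $B$ to be irreducible. Kemeny's constant of an irreducible stochastic $N\times N$ matrix $Q$ with eigenvalues $\lambda_1=1,\lambda_2,\dots,\lambda_N$ (with algebraic multiplicity) is $\kappa(Q)=\sum_{i=2}^N\frac{1}{1-\lambda_i}$; equivalently $\kappa(Q)=\operatorname{Tr}\big((I-Q+\mathbf{1}\mathbf{h}^T)^{-1}\big)-1$ for any $\mathbf{h}$ with $\mathbf{h}^T\mathbf{1}=1$. *)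

(* Defs.v *)
From mathcomp Require Import all_boot all_order all_algebra.
From mathcomp Require Import reals complex mxtens.

Set Implicit Arguments.
Unset Strict Implicit.
Unset Printing Implicit Defensive.

Import GRing.Theory Num.Theory.
Local Open Scope ring_scope.

Section Definitions.
Variable R : realType.

Definition ones {n : nat} : 'cV[R]_n := const_mx 1.

Definition stochastic {n : nat} (Q : 'M[R]_n) : Prop :=
  (forall i j, 0 <= Q i j) /\ Q *m ones = ones.

(* Strong connectivity of the digraph with an arc i -> j iff Q i j != 0. *)
Definition irreducible {n : nat} (Q : 'M[R]_n) : Prop :=
  forall i j, connect [rel k l | Q k l != 0] i j.

(* For irreducible stochastic Q there is exactly one such vector. *)
Definition stationary {n : nat} (Q : 'M[R]_n) (pi : 'cV[R]_n) : Prop :=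
  pi^T *m Q = pi^T /\ pi^T *m ones = 1%:M.

(* The complex eigenvalues of Q, listed with algebraic multiplicity (see
   char_poly_eigenvalues); the order is unspecified. *)
Definition eigenvalues {n : nat} (Q : 'M[R]_n) : seq R[i] :=
  sval (closed_field_poly_normal (char_poly (map_mx (real_complex R) Q))).

(* [rem] deletes a single occurrence of the eigenvalue 1. *)
Definition kemeny {n : nat} (Q : 'M[R]_n) : R[i] :=
  \sum_(l <- rem 1 (eigenvalues Q)) (1 - l)^-1.

Lemma char_poly_eigenvalues n (Q : 'M[R]_n) :
  char_poly (map_mx (real_complex R) Q)
    = \prod_(l <- eigenvalues Q) ('X - l%:P).
Proof.
rewrite /eigenvalues; case: closed_field_poly_normal => s /= ->.
by rewrite (monicP (char_poly_monic _)) scale1r.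
Qed.

(* [A *t B] is the Kronecker product. Its leading m x m block is a_11 B and the
   complementary block is (a_ij)_(i, j >= 2) *t B, the dimension n.+1 * m being
   convertible to m + n * m. *)
Lemma ulsubmx_tensmx n m (A : 'M[R]_n.+1) (B : 'M[R]_m) :
  ulsubmx ((A *t B) : 'M_(m + n * m)) = A 0 0 *: B.
Proof.
apply/matrixP=> i j; rewrite !mxE; congr (A _ _ * B _ _); apply: val_inj => /=;
  by rewrite ?divn_small ?modn_small.
Qed.

Lemma drsubmx_tensmx n m (A : 'M[R]_n.+1) (B : 'M[R]_m) :
  drsubmx ((A *t B) : 'M_(m + n * m)) = row' 0 (col' 0 A) *t B.
Proof.
apply/matrixP=> i j.
have m0 : (0 < m)%N by case: (m) i => [|//] [k]; rewrite muln0.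
rewrite !mxE; congr (A _ _ * B _ _); apply: val_inj => /=;
  by rewrite ?divnDl ?divnn ?m0 ?modnDl.
Qed.

End Definitions.

Arguments ones {R n}.

(* Main.v *)
(* For idempotent rank-one C = 1 y^T, the deflated matrix P' = A *t (B - C) has I - P'
   invertible, and since the diagonal blocks of (I - P')^-1 are the inverses of I - P1'
   and I - P2', where P1' and P2' are the complements in P',
     tr (I - P')^-1 = tr (I - P1')^-1 + tr (I - P2')^-1.
   Deflation only removes the spectral part living on the range of I *t C, where P acts
   as A, P1 as the scalar 1, and P2 as the stochastic complement A2 of a_11 in A. Hence
   kappa(P) - kappa(P1) - kappa(P2) = kappa(A) - kappa(A2), and the right-hand side is
   read off the blocks of the fundamental matrix (I - A + 1 x^T)^-1. *)
Require Import Defs.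
From mathcomp Require Import all_boot all_order all_algebra.
From mathcomp Require Import reals complex mxtens spectral ring.

Set Implicit Arguments.
Unset Strict Implicit.
Unset Printing Implicit Defensive.

Import Order.TTheory GRing.Theory Num.Theory.
Local Open Scope ring_scope.

(** * Trace formula for Kemeny's constant *)

(** The matrix determinant lemma, multiplied by [a] so that [a] need not be invertible. The bordered
    matrix [M] is reduced to block triangular form in two ways. *)
Lemma det_scalar_rank1 (R : comNzRingType) n (a : R) (u : 'cV[R]_n) (v : 'rV[R]_n) :
  a * \det (a%:M + u *m v) = a ^+ n * (a + (v *m u) 0 0).
Proof.
pose M : 'M[R]_(n + 1) := block_mx a%:M u (- v) 1%:M.
have lower : M *m block_mx 1%:M 0 v 1%:M = block_mx (a%:M + u *m v) u 0 1%:M.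
  by rewrite mulmx_block !mulmx1 !mulmx0 !mul1mx add0r addNr add0r.
have upper : M *m block_mx 1%:M (- u) 0 a%:M
    = block_mx a%:M 0 (- v) (v *m u + a%:M).
  rewrite mulmx_block !mulmx1 !mulmx0 !mul1mx !addr0 mul_scalar_mx mul_mx_scalar.
  by rewrite scalerN addNr mulNmx mulmxN opprK.
have detM : \det M = \det (a%:M + u *m v).
  have /(congr1 determinant) := lower.
  by rewrite det_mulmx det_lblock det_ublock !det1 !mulr1.
have /(congr1 determinant) := upper.
rewrite det_mulmx det_ublock det_lblock det1 !det_scalar1 det_scalar mul1r detM.
by rewrite det_mx11 !mxE eqxx mulr1n mulrC addrC.
Qed.

(** Subtracting [u v] trades one eigenvalue 1 for 0. Since (X - Q) u = (X - 1) u, one has (X - Q)((X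
    - 1) + u v) = (X - 1)(X - (Q - u v)); determinants are taken and (X - 1)^n is cancelled. *)
Lemma char_poly_deflate (R : idomainType) n (Q : 'M[R]_n) (u : 'cV[R]_n) (v : 'rV[R]_n) :
  Q *m u = u -> v *m u = 1%:M ->
  'X * char_poly Q = ('X - 1) * char_poly (Q - u *m v).
Proof.
move=> Qu vu; set a : {poly R} := 'X - 1.
have a0 : a != 0 by rewrite /a -(rmorph1 polyC) polyXsubC_eq0.
pose up := map_mx polyC u; pose vp := map_mx polyC v.
have vup : vp *m up = 1%:M by rewrite -map_mxM vu map_scalar_mx.
have Qup : char_poly_mx Q *m up = a *: up.
  by rewrite mulmxBl -map_mxM Qu mul_scalar_mx scalerBl scale1r.
have E : char_poly_mx Q *m (a%:M + up *m vp) = a *: char_poly_mx (Q - u *m v).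
  rewrite mulmxDr mul_mx_scalar mulmxA Qup -scalemxAl -scalerDr; congr (_ *: _).
  by rewrite /char_poly_mx map_mxB map_mxM opprB addrA addrAC.
have /(congr1 (fun M => a * \det M)) := E.
rewrite det_mulmx mulrCA det_scalar_rank1 detZ vup mxE eqxx.
rewrite -/(char_poly Q) -/(char_poly _) => H.
apply: (mulfI (expf_neq0 n a0)); rewrite [RHS]mulrCA -H /a mulr1n subrK.
by rewrite [RHS]mulrCA [in RHS](mulrC (char_poly _)).
Qed.

Lemma char_poly_conj (F : fieldType) n (P M : 'M[F]_n) :
  P \in unitmx -> char_poly (conjmx P M) = char_poly M.
Proof.
move=> Pu; rewrite conjumx //.
have E : char_poly_mx (P *m M *m invmx P)
    = map_mx polyC P *m char_poly_mx M *m map_mx polyC (invmx P).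
  have PP : map_mx polyC P *m map_mx polyC (invmx P) = 1%:M.
    by rewrite -map_mxM mulmxV // map_scalar_mx.
  rewrite /char_poly_mx mulmxBr mulmxBl !map_mxM /= mul_mx_scalar -scalemxAl.
  by rewrite PP scalemx1.
rewrite /char_poly E !det_mulmx mulrAC -det_mulmx -map_mxM mulmxV //.
by rewrite map_scalar_mx det1 mul1r.
Qed.

Lemma trig_mul_diag (R : pzRingType) n (S T : 'M[R]_n) i :
  is_trig_mx S -> is_trig_mx T -> (S *m T) i i = S i i * T i i.
Proof.
move=> /is_trig_mxP Str /is_trig_mxP Ttr; rewrite mxE (bigD1 i) //= big1 ?addr0 // => j.
rewrite neq_ltn => /orP[ji|ij]; first by rewrite Ttr ?mulr0.
by rewrite Str ?mul0r.
Qed.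

(** [M] commutes with its resolvent, so one basis makes both triangular. There the diagonal of [M]
    lists [s] up to order, and the diagonal of the resolvent is its entrywise image under l -> 1/(1
    - l). *)
Lemma mxtrace_inv_resolvent (C : numClosedFieldType) n (M : 'M[C]_n) (s : seq C) :
  char_poly M = \prod_(l <- s) ('X - l%:P) -> 1%:M - M \in unitmx ->
  \tr (invmx (1%:M - M)) = \sum_(l <- s) (1 - l)^-1.
Proof.
move=> chM Mu; set N := invmx _.
have comm : M *m N = N *m M.
  have: (1%:M - M) *m N = N *m (1%:M - M) by rewrite mulmxV ?mulVmx.
  by rewrite mulmxBl mulmxBr mul1mx mulmx1 => /addrI/oppr_inj.
have [P /unitarymx_unit Pu /andP[Mtr Ntr]] := cotrigonalization2 comm.
rewrite /simmx_to_for /= in Mtr Ntr.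
have s_diag : perm_eq s [seq conjmx P M i i | i : 'I_n].
  by apply: prod_XsubC_eq; rewrite -chM -(char_poly_conj M Pu) char_poly_trig // big_image.
rewrite (perm_big _ s_diag) big_image /=.
have -> : \tr N = \tr (conjmx P N).
  by rewrite conjumx // mxtrace_mulC mulmxA mulVmx // mul1mx.
have conjN : (conjmx P N) - conjmx P M *m conjmx P N = 1%:M.
  have NMN : N - M *m N = 1%:M by rewrite -{1}[N]mul1mx -mulmxBl mulmxV.
  rewrite !conjumx // !mulmxA mulmxKV // -mulmxBl -mulmxA -mulmxBr NMN.
  by rewrite mulmx1 mulmxV.
apply: eq_bigr => i _; apply/esym/mulr1_eq.
rewrite mulrBl mul1r -trig_mul_diag //; have /matrixP/(_ i i) := conjN.
by move=> NMN; rewrite [LHS]mxE [X in _ + X]mxE [RHS]mxE eqxx in NMN.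
Qed.

(** After deflation the eigenvalue 0 stands in place of one eigenvalue 1; it adds 1/(1 - 0) = 1 to
    the trace, which the final -1 removes. *)
Lemma kemeny_tr (R : realType) n (Q : 'M[R]_n) (u : 'cV[R]_n) (v : 'rV[R]_n) :
  Q *m u = u -> v *m u = 1%:M ->
  1%:M - (Q - u *m v) \in unitmx ->
  kemeny Q = (\tr (invmx (1%:M - (Q - u *m v))) - 1)%:C%C.
Proof.
move=> Qu vu Zu; pose f : {rmorphism R -> R[i]%C} := real_complex R.
have := char_poly_deflate Qu vu => /(congr1 (map_poly f)).
rewrite !rmorphM rmorphB rmorph1 /= map_polyX !map_char_poly (char_poly_eigenvalues Q).
set s := eigenvalues Q => deflate.
(* Evaluating the deflation identity at 1 shows that 1 is a root, so [rem] really deletes an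
   occurrence. *)
have s1 : 1 \in s.
  rewrite -root_prod_XsubC; have := congr1 (fun p => p.[1]) deflate.
  by rewrite /= !hornerM !hornerE subrr mul0r => /eqP.
have charD : char_poly (map_mx f (Q - u *m v)) = \prod_(l <- 0 :: rem 1 s) ('X - l%:P).
  apply: (mulfI (_ : 'X - 1 != 0)); first by rewrite -(rmorph1 polyC) polyXsubC_eq0.
  rewrite -[LHS]deflate (perm_big _ (perm_to_rem s1)) /= 2!big_cons.
  rewrite [LHS]mulrCA; congr (_ * _).
  by rewrite subr0.
have fZ : map_mx f (1%:M - (Q - u *m v)) = 1%:M - map_mx f (Q - u *m v).
  by rewrite map_mxB map_scalar_mx rmorph1.
rewrite -[(_ - 1)%:C%C]/(f _) rmorphB rmorph1 -trace_map_mx map_invmx fZ.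
rewrite (mxtrace_inv_resolvent charD); last by rewrite -fZ map_unitmx.
by rewrite big_cons subr0 invr1 [RHS]addrAC subrr add0r.
Qed.

(** * Stochastic complements *)

Section MatrixInverse.
Variable F : fieldType.

Lemma invmx_uniq n (M N : 'M[F]_n) : M *m N = 1%:M -> M \in unitmx /\ invmx M = N.
Proof.
move=> MN; have [Mu _] := mulmx1_unit MN; split=> //.
by rewrite -[LHS]mulmx1 -MN mulKmx.
Qed.

Lemma unitmx_ker0 n (M : 'M[F]_n) :
  (forall u : 'cV[F]_n, M *m u = 0 -> u = 0) -> M \in unitmx.
Proof.
move=> ker0; rewrite -unitmx_tr -row_free_unit -kermx_eq0; apply/eqP/row_matrixP => i.
rewrite row0; apply: trmx_inj; rewrite trmx0; apply: ker0; apply: trmx_inj.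
by rewrite trmx_mul trmxK -row_mul mulmx_ker row0 trmx0.
Qed.

Lemma invmx_comm n (M E : 'M[F]_n) : M \in unitmx -> M *m E = E *m M ->
  invmx M *m E = E *m invmx M.
Proof. by move=> Mu ME; rewrite -{1}[E](mulmxK Mu) -ME -!mulmxA mulKmx. Qed.

End MatrixInverse.

Section StochasticComplement.
Variable F : fieldType.

(** Stochastic complement of the upper-left block: 1 - [compl_ul P] is the Schur complement of 1 -
    P22 in 1 - P. *)
Definition compl_ul p q (P : 'M[F]_(p + q)) : 'M[F]_p :=
  ulsubmx P + ursubmx P *m invmx (1%:M - drsubmx P) *m dlsubmx P.

Definition compl_dr p q (P : 'M[F]_(p + q)) : 'M[F]_q :=
  drsubmx P + dlsubmx P *m invmx (1%:M - ulsubmx P) *m ursubmx P.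

(** Eliminating the off-diagonal blocks of K from (1 - P) K = 1 shows that the diagonal blocks of K
    invert the two Schur complements. *)
Lemma compl_resolvent p q (P : 'M[F]_(p + q)) :
  1%:M - P \in unitmx -> 1%:M - ulsubmx P \in unitmx -> 1%:M - drsubmx P \in unitmx ->
  [/\ 1%:M - compl_ul P \in unitmx, 1%:M - compl_dr P \in unitmx
    & \tr (invmx (1%:M - P))
      = \tr (invmx (1%:M - compl_ul P)) + \tr (invmx (1%:M - compl_dr P))].
Proof.
move=> Pu ulu dru; set K := invmx (1%:M - P).
have PK : (1%:M - P) *m K = 1%:M by rewrite mulmxV.
have subE : 1%:M - P = block_mx (1%:M - ulsubmx P) (- ursubmx P)
                                (- dlsubmx P) (1%:M - drsubmx P).
  by rewrite -{1}[P]submxK scalar_mx_block opp_block_mx add_block_mx !add0r.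
move: PK; rewrite subE -[K]submxK mulmx_block scalar_mx_block => /eq_block_mx.
rewrite !mulNmx => -[K11 K12 K21 K22].
have E21 : dlsubmx K = invmx (1%:M - drsubmx P) *m dlsubmx P *m ulsubmx K.
  rewrite -[LHS](mulKmx dru) -!mulmxA; congr (_ *m _).
  by apply/eqP; rewrite -subr_eq0 addrC K21.
have E12 : ursubmx K = invmx (1%:M - ulsubmx P) *m ursubmx P *m drsubmx K.
  rewrite -[LHS](mulKmx ulu) -!mulmxA; congr (_ *m _).
  by apply/eqP; rewrite -subr_eq0 K12.
have [u1 i1] : 1%:M - compl_ul P \in unitmx /\ invmx (1%:M - compl_ul P) = ulsubmx K.
  by apply: invmx_uniq; rewrite opprD addrA mulmxBl -[RHS]K11 E21 !mulmxA.
have [u2 i2] : 1%:M - compl_dr P \in unitmx /\ invmx (1%:M - compl_dr P) = drsubmx K.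
  by apply: invmx_uniq; rewrite opprD addrA mulmxBl -[RHS]K22 E12 !mulmxA [RHS]addrC.
by split=> //; rewrite i1 i2 mxtrace_block.
Qed.

(** The lower block row of P u = u gives u2 = (1 - P22)^-1 P21 u1, which is substituted in the upper
    one. *)
Lemma compl_ul_fixed p q (P : 'M[F]_(p + q)) (u1 : 'cV[F]_p) (u2 : 'cV[F]_q) :
  1%:M - drsubmx P \in unitmx -> P *m col_mx u1 u2 = col_mx u1 u2 ->
  compl_ul P *m u1 = u1.
Proof.
move=> dru; rewrite -{1}[P]submxK mul_block_col => /eq_col_mx[Pu1 Pu2].
rewrite mulmxDl -!mulmxA -[RHS]Pu1; congr (_ + _ *m _).
by apply: (canLR (mulKmx dru)); rewrite mulmxBl mul1mx; apply: (canRL (addrK _)).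
Qed.

Lemma compl_dr_fixed p q (P : 'M[F]_(p + q)) (u1 : 'cV[F]_p) (u2 : 'cV[F]_q) :
  1%:M - ulsubmx P \in unitmx -> P *m col_mx u1 u2 = col_mx u1 u2 ->
  compl_dr P *m u2 = u2.
Proof.
move=> ulu; rewrite -{1}[P]submxK mul_block_col => /eq_col_mx[Pu1 Pu2].
rewrite mulmxDl -!mulmxA -[RHS]Pu2 addrC; congr (_ *m _ + _).
apply: (canLR (mulKmx ulu)); rewrite mulmxBl mul1mx.
by apply: (canRL (addrK _)); rewrite addrC.
Qed.

(** Cutting down by a commuting block-diagonal projection is compatible with taking complements. It
    will be used with the projection that deflates P. *)
Lemma compl_proj p q (P : 'M[F]_(p + q)) (F1 : 'M[F]_p) (F2 : 'M[F]_q) :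
  let D := block_mx F1 0 0 F2 in let P' := P *m D in
  D *m D = D -> P *m D = D *m P ->
  1%:M - ulsubmx P \in unitmx -> 1%:M - ulsubmx P' \in unitmx ->
  1%:M - drsubmx P \in unitmx -> 1%:M - drsubmx P' \in unitmx ->
  compl_ul P' = compl_ul P *m F1 /\ compl_dr P' = compl_dr P *m F2.
Proof.
move=> D P' DD PD ulu ulu' dru dru'.
have PE : P' = block_mx (ulsubmx P *m F1) (ursubmx P *m F2)
                        (dlsubmx P *m F1) (drsubmx P *m F2).
  by rewrite /P' /D -{1}[P]submxK mulmx_block !mulmx0 !add0r !addr0.
have := PD; rewrite -/P' PE -[P in D *m P]submxK mulmx_block !mul0mx !add0r !addr0.
move=> /eq_block_mx[c11 c12 c21 c22].
have := DD; rewrite mulmx_block !mul0mx !mulmx0 !add0r !addr0 => /eq_block_mx[i1 _ _ i2].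
(* On the range of the projection [G] the resolvents of X and X G agree, because (1 - X) G = G (1 -
   X G). *)
have key r (X G : 'M[F]_r) : G *m G = G -> X *m G = G *m X ->
  1%:M - X \in unitmx -> 1%:M - X *m G \in unitmx ->
  G *m invmx (1%:M - X *m G) *m G = invmx (1%:M - X) *m G.
  move=> GG XG Xu XGu; rewrite -invmx_comm //; last first.
    by rewrite mulmxBl mulmxBr mulmx1 mul1mx mulmxA -XG.
  rewrite -mulmxA GG; apply: (canRL (mulKmx Xu)).
  have -> : (1%:M - X) *m (invmx (1%:M - X *m G) *m G)
    = (1%:M - X) *m G *m invmx (1%:M - X *m G).
    rewrite invmx_comm ?mulmxA //.
    by rewrite mulmxBl mulmxBr mulmx1 mul1mx mulmxA -XG.
  have -> : (1%:M - X) *m G = G *m (1%:M - X *m G).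
    by rewrite mulmxBl mulmxBr mulmx1 mul1mx mulmxA -XG -mulmxA GG.
  by rewrite mulmxK.
move: ulu' dru'; rewrite /compl_ul /compl_dr PE.
rewrite !(block_mxKul, block_mxKur, block_mxKdl, block_mxKdr) => ulu' dru'.
split; rewrite mulmxDl; congr (_ + _).
  rewrite c21 -[RHS]mulmxA c21 !mulmxA; congr (_ *m _).
  by rewrite -!mulmxA; congr (_ *m _); rewrite mulmxA key.
rewrite c12 -[RHS]mulmxA c12 !mulmxA; congr (_ *m _).
by rewrite -!mulmxA; congr (_ *m _); rewrite mulmxA key.
Qed.

Lemma compl_dr_comm p q (P : 'M[F]_(p + q)) (E1 : 'M[F]_p) (E2 : 'M[F]_q) :
  1%:M - ulsubmx P \in unitmx ->
  P *m block_mx E1 0 0 E2 = block_mx E1 0 0 E2 *m P ->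
  compl_dr P *m E2 = E2 *m compl_dr P.
Proof.
move=> ulu; rewrite -{1 2}[P]submxK !mulmx_block !mulmx0 !mul0mx !add0r !addr0.
move=> /eq_block_mx[c11 c12 c21 c22]; rewrite mulmxDl mulmxDr c22; congr (_ + _).
rewrite -mulmxA c12 !mulmxA -c21; congr (_ *m _); rewrite -!mulmxA; congr (_ *m _).
by rewrite invmx_comm // mulmxBl mulmxBr mulmx1 mul1mx c11.
Qed.

(** The tail of [v] has mass 1 - a against [u2]; this is the scaling that makes it a normalized
    deflation vector for the complement. *)
Lemma normalized_tail q (a : F) (u2 : 'cV[F]_q) (v2 : 'rV[F]_q) :
  row_mx a%:M v2 *m col_mx 1%:M u2 = 1%:M -> a != 1 ->
  ((1 - a)^-1 *: v2) *m u2 = 1%:M.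
Proof.
rewrite mul_row_col mulmx1 addrC eq_sym -subr_eq0 => /(canRL (addrK _)) e a1.
by rewrite -scalemxAl e -raddfB /= scale_scalar_mx mulVf.
Qed.

(* Deleting the first row and column of a fundamental matrix [Z] and correcting by a
   rank-one term yields a solution [W] of [(1 - compl_dr A) W = 1 - u2 xi]. *)
Lemma fundamental_compl_dr q (A : 'M[F]_(1 + q)) (a : F) (u2 : 'cV[F]_q) (v2 : 'rV[F]_q) :
  let u := col_mx 1%:M u2 in let v := row_mx a%:M v2 in let xi := (1 - a)^-1 *: v2 in
  A *m u = u -> v *m A = v -> v *m u = 1%:M -> a != 1 ->
  1%:M - ulsubmx A \in unitmx -> 1%:M - (A - u *m v) \in unitmx ->
  1%:M - (compl_dr A - u2 *m xi) \in unitmx /\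
  \tr (invmx (1%:M - (A - u *m v))) =
    \tr (invmx (1%:M - (compl_dr A - u2 *m xi)))
    + (1 - a)^-1 * (invmx (1%:M - (A - u *m v)) 0 0 - a).
Proof.
move=> u v xi Au vA vu; rewrite eq_sym -subr_eq0 => a1 ulu Zu.
set Z := invmx (1%:M - (A - u *m v)).
have Ze : (1%:M - (A - u *m v)) *m u = u.
  by rewrite mulmxBl mulmxBl mul1mx Au -mulmxA vu mulmx1 subrr subr0.
have eZ : v *m (1%:M - (A - u *m v)) = v.
  by rewrite mulmxBr mulmxBr mulmx1 vA mulmxA vu mul1mx subrr subr0.
have Zuu : Z *m u = u by rewrite -{1}Ze mulKmx.
have vZ : v *m Z = v by rewrite -{1}eZ mulmxK.
have LZ : (1%:M - A) *m Z = 1%:M - u *m v.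
  have ZZ := mulmxV Zu; rewrite -/Z opprB addrCA mulmxDl -mulmxA vZ in ZZ.
  by rewrite (canRL (addKr _) ZZ) addrC.
have xiu : xi *m u2 = 1%:M by apply: normalized_tail vu _; rewrite eq_sym -subr_eq0.
have xiE : v2 + a *: xi = xi.
  by rewrite -{1}[v2](scalerKV a1) -/xi -scalerDl subrK scale1r.
(* Adding the first block column of [Z] times [xi] makes the upper-right block of (1 - A) Z vanish,
   as -v2 + (1 - a) xi = 0. Hence [w] can be eliminated in favour of [W]. *)
pose w := ursubmx Z + ulsubmx Z *m xi; pose W := drsubmx Z + dlsubmx Z *m xi.
have subE : 1%:M - A = block_mx (1%:M - ulsubmx A) (- ursubmx A)
                                (- dlsubmx A) (1%:M - drsubmx A).
  by rewrite -{1}[A]submxK scalar_mx_block opp_block_mx add_block_mx !add0r.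
have bLZ := LZ; rewrite subE -[Z]submxK mulmx_block /u /v mul_col_row in bLZ.
rewrite scalar_mx_block opp_block_mx add_block_mx in bLZ.
rewrite !add0r !mulNmx !mul1mx mul_mx_scalar in bLZ.
case/eq_block_mx: bLZ => [Z11 Z12 Z21 Z22].
have row1 : (1%:M - ulsubmx A) *m w - ursubmx A *m W = 0.
  rewrite /w /W !mulmxDr !mulmxA opprD addrACA Z12 -mulmxBl Z11.
  by rewrite -raddfB /= mul_scalar_mx scalerA mulfV // scale1r addNr.
have row2 : (1%:M - drsubmx A) *m W - dlsubmx A *m w = 1%:M - u2 *m xi.
  rewrite /w /W !mulmxDr !mulmxA opprD addrACA -mulmxBl addrC [in X in _ + X]addrC Z22.
  rewrite [X in X *m xi + _]addrC Z21 mulNmx -scalemxAl addrC -addrA -opprD -{2}xiE.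
  by rewrite mulmxDr -!scalemxAr.
have compW : (1%:M - compl_dr A) *m W = 1%:M - u2 *m xi.
  rewrite opprD addrA mulmxBl -row2 -!mulmxA; congr (_ - _ *m _).
  by apply: (canLR (mulKmx ulu)); apply/esym/eqP; rewrite -subr_eq0 row1.
have Wu2 : W *m u2 = u2.
  have := Zuu; rewrite -{1}[Z]submxK mul_block_col !mulmx1 => /eq_col_mx[_ Zu2].
  by rewrite -[RHS]Zu2 mulmxDl -mulmxA xiu mulmx1 addrC.
have Cu2 : compl_dr A *m u2 = u2 by apply: compl_dr_fixed Au.
(* The inverse is [W] projected off the fixed direction by 1 - u2 xi, plus the identity on that
   direction. The two corrections have traces -1 and 1, so its trace is that of [W]. *)
have [Z2u ->] : 1%:M - (compl_dr A - u2 *m xi) \in unitmx /\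
    invmx (1%:M - (compl_dr A - u2 *m xi)) = W - u2 *m xi *m W + u2 *m xi.
  apply: invmx_uniq; rewrite opprB addrCA mulmxDl.
  have C0 (X : 'rV_q) : (1%:M - compl_dr A) *m (u2 *m X) = 0.
    by rewrite mulmxA mulmxBl mul1mx Cu2 subrr mul0mx.
  have J (X : 'rV_q) : u2 *m xi *m (u2 *m X) = u2 *m X.
    by rewrite -mulmxA (mulmxA xi) xiu mul1mx.
  rewrite -[u2 *m xi *m W]mulmxA [(1%:M - _) *m _]mulmxDr [(1%:M - _) *m (W - _)]mulmxBr.
  by rewrite !C0 subr0 addr0 compW mulmxDr mulmxBr !J mulmxA subrr add0r addrC subrK.
split=> //.
have trW : \tr (u2 *m xi *m W) = 1.
  by rewrite -mulmxA mxtrace_mulC -mulmxA Wu2 xiu mxtrace1.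
(* The first entry of v Z = v determines v2 Z21, hence the trace by which [W] differs from the
   lower-right block of [Z]. *)
have z21 : \tr (dlsubmx Z *m xi) = (1 - a)^-1 * (a - a * Z 0 0).
  have := vZ; rewrite -{1}[Z]submxK mul_row_block => /eq_row_mx[vz _].
  rewrite mxtrace_mulC -scalemxAl mxtraceZ; congr (_ * _).
  have /(canRL (addKr _))-> := vz; rewrite raddfD raddfN /= mul_scalar_mx mxtraceZ.
  rewrite mxtrace_scalar addrC; congr (_ - _ * _).
  by rewrite trace_mx11 !mxE; congr (Z _ _); apply: val_inj.
have trZ : \tr Z = Z 0 0 + \tr (drsubmx Z).
  rewrite -{1}[Z]submxK mxtrace_block trace_mx11 !mxE; congr (Z _ _ + _); exact: val_inj.
rewrite trZ mxtraceD raddfB /= trW (mxtrace_mulC u2) xiu mxtrace1 subrK mxtraceD z21.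
by field.
Qed.

End StochasticComplement.

(** * Kronecker products *)

Section Tensor.
Variable F : fieldType.

Lemma tensmxBl m n p q (A A' : 'M[F]_(m, n)) (B : 'M[F]_(p, q)) :
  (A - A') *t B = A *t B - A' *t B.
Proof. by apply/matrixP=> i j; rewrite !mxE mulrBl. Qed.

Lemma tensmxDl m n p q (A A' : 'M[F]_(m, n)) (B : 'M[F]_(p, q)) :
  (A + A') *t B = A *t B + A' *t B.
Proof. by apply/matrixP=> i j; rewrite !mxE mulrDl. Qed.

Lemma tensmxZl m n p q a (A : 'M[F]_(m, n)) (B : 'M[F]_(p, q)) :
  (a *: A) *t B = a *: (A *t B).
Proof. by apply/matrixP=> i j; rewrite !mxE mulrA. Qed.

Lemma tens1mx1 n m : 1%:M *t 1%:M = 1%:M :> 'M[F]_(n * m).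
Proof.
apply/matrixP=> i j; case: (mxtens_indexP i) => i1 i2.
case: (mxtens_indexP j) => j1 j2; rewrite tensmxE !mxE -natrM mulnb.
by rewrite (can_eq (@mxtens_indexK _ _)).
Qed.

Lemma mxtrace_tens n m (A : 'M[F]_n) (B : 'M[F]_m) : \tr (A *t B) = \tr A * \tr B.
Proof. by rewrite /mxtrace mulr_sum; apply: eq_bigr => i _; rewrite mxE. Qed.

(* [Q'] lives on the range of [1 - 1 *t C] and [N *t C] on the complementary range of
   [1 *t C], so the resolvent of the sum splits. *)
Lemma resolvent_tens k m (Q' : 'M[F]_(k * m)) (N : 'M[F]_k) (C : 'M[F]_m) :
  C *m C = C -> \tr C = 1 -> Q' *m (1%:M *t C) = 0 -> (1%:M *t C) *m Q' = 0 ->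
  1%:M - Q' \in unitmx -> 1%:M - N \in unitmx ->
  1%:M - (Q' + N *t C) \in unitmx /\
  \tr (invmx (1%:M - (Q' + N *t C)))
    = \tr (invmx (1%:M - Q')) + \tr (invmx (1%:M - N)) - k%:R.
Proof.
set E := 1%:M *t C => CC trC QE EQ Qu Nu.
(* The resolvent of [Q'] is already the identity on the range of [E]; subtracting [E] keeps that
   range from being counted twice. *)
pose G := invmx (1%:M - Q') + invmx (1%:M - N) *t C - E.
have EN (X : 'M[F]_k) : E *m (X *t C) = X *t C by rewrite tensmx_mul mul1mx CC.
have Q0 (X : 'M[F]_k) : Q' *m (X *t C) = 0 by rewrite -EN mulmxA QE mul0mx.
have CI : (N *t C) *m invmx (1%:M - Q') = N *t C.
  apply: (canLR (mulmxK Qu)); rewrite mulmxBr mulmx1.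
  have -> : N *t C = (N *t C) *m E by rewrite tensmx_mul mulmx1 CC.
  by rewrite -mulmxA EQ mulmx0 subr0.
have NI : N *m invmx (1%:M - N) = invmx (1%:M - N) - 1%:M.
  by rewrite -{1}[N](subKr 1%:M) mulmxBl mul1mx mulmxV.
have [u ->] : 1%:M - (Q' + N *t C) \in unitmx /\ invmx (1%:M - (Q' + N *t C)) = G.
  apply: invmx_uniq; rewrite opprD addrA mulmxBl /G.
  rewrite [X in X - _]mulmxBr [X in X - _ - _]mulmxDr mulmxV // !mulmxBl !mul1mx.
  rewrite Q0 QE !subr0.
  rewrite mulmxBr mulmxDr CI !tensmx_mul CC NI mulmx1 tensmxBl -/E.
  by rewrite [N *t C + _]addrC addrK -[_ + _ - E]addrA addrK.
by rewrite raddfB /= mxtraceD !mxtrace_tens trC mxtrace1 !mulr1.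
Qed.

End Tensor.

(** * Blocks and complements of Kronecker products *)

Section SubmatrixOfTensor.
Variable R : realType.

Lemma drsubmx_row'col' n (A : 'M[R]_n.+1) : drsubmx (A : 'M_(1 + n)) = row' 0 (col' 0 A).
Proof. by apply/matrixP=> i j; rewrite !mxE; congr (A _ _); apply: val_inj. Qed.

Lemma tens1_block n m (C : 'M[R]_m) :
  (1%:M : 'M_n.+1) *t C = block_mx C 0 0 ((1%:M : 'M_n) *t C) :> 'M_(m + n * m).
Proof.
rewrite -[LHS](@submxK _ m (n * m) m (n * m)); congr block_mx.
- by rewrite ulsubmx_tensmx mxE eqxx scale1r.
- apply/matrixP => i j; rewrite !mxE; set b := _ == _.
  suff /negbTE-> : ~~ b by rewrite mul0r.
  rewrite /b -val_eqE /=.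
  have m0 : (0 < m)%N by apply: leq_ltn_trans (ltn_ord i).
  by rewrite divn_small // divnDl // divnn m0.
- apply/matrixP => i j; rewrite !mxE; set b := _ == _.
  suff /negbTE-> : ~~ b by rewrite mul0r.
  rewrite /b -val_eqE /=.
  have m0 : (0 < m)%N by apply: leq_ltn_trans (ltn_ord j).
  by rewrite divnDl // divnn m0 (divn_small (ltn_ord j)).
- rewrite drsubmx_tensmx; congr (_ *t _).
  by apply/matrixP=> i j; rewrite !mxE (inj_eq lift_inj).
Qed.

Lemma drsubmx_mul p q (X Y : 'M[R]_(p + q)) :
  drsubmx (X *m Y) = dlsubmx X *m ursubmx Y + drsubmx X *m drsubmx Y.
Proof. by rewrite -{1}[X]submxK -{1}[Y]submxK mulmx_block block_mxKdr. Qed.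

(** On the range of 1 *t C the factor B acts as the identity. In particular (1 - a B)^-1 C = (1 -
    a)^-1 C, so the complement of the product collapses to that of [A]. *)
Lemma compl_dr_tens n m (A : 'M[R]_n.+1) (B C : 'M[R]_m) :
  C *m C = C -> B *m C = C -> C *m B = C ->
  1%:M - ulsubmx (A : 'M_(1 + n)) \in unitmx ->
  1%:M - A 0 0 *: B \in unitmx ->
  compl_dr ((A *t B) : 'M_(m + n * m)) *m (1%:M *t C)
    = compl_dr (A : 'M_(1 + n)) *t C.
Proof.
move=> CC BC CB; set a := A 0 0.
have aE : ulsubmx (A : 'M_(1 + n)) = a%:M.
  by rewrite [LHS]mx11_scalar !mxE; congr ((A _ _)%:M); apply: val_inj.
have subE : 1%:M - a%:M = (1 - a)%:M :> 'M[R]_1 by rewrite raddfB.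
rewrite /compl_dr ulsubmx_tensmx -/a aE subE => au Bu.
have a0 : 1 - a != 0 by rewrite unitmxE det_scalar1 unitfE in au.
pose P : 'M_(m + n * m) := A *t B; pose T : 'M_(m + n * m) := A *t C.
pose E : 'M_(m + n * m) := (1%:M : 'M_n.+1) *t C.
have PE : P *m E = T by rewrite [LHS](tensmx_mul A B 1%:M C) mulmx1 BC.
have EP : E *m P = T by rewrite [LHS](tensmx_mul 1%:M C A B) mul1mx CB.
have := PE; rewrite -[P]submxK /E tens1_block -[T]submxK mulmx_block.
rewrite !mulmx0 !add0r !addr0 => /eq_block_mx[_ r12 r21 r22].
have := EP; rewrite -[P]submxK /E tens1_block -[T]submxK mulmx_block.
rewrite !mul0mx !add0r !addr0 => /eq_block_mx[_ l12 l21 l22].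
have NC : invmx (1%:M - a *: B) *m C = (1 - a)^-1 *: C.
  apply: (canLR (mulKmx Bu)); rewrite -scalemxAr mulmxBl mul1mx -scalemxAl BC.
  by rewrite -{2}[C]scale1r -scalerBl scalerA mulVf // scale1r.
have TT : T *m T = (A *m A) *t C by rewrite [LHS](tensmx_mul A C A C) CC.
(* The product of off-diagonal blocks is read off the lower-right block of T T = (A A) *t C, after
   removing the product of the diagonal ones. *)
have T21 : dlsubmx T *m ursubmx T
    = (dlsubmx (A : 'M_(1 + n)) *m ursubmx (A : 'M_(1 + n))) *t C.
  have := congr1 (fun X : 'M_(m + n * m) => drsubmx X) TT.
  rewrite /= drsubmx_mul !drsubmx_tensmx tensmx_mul CC -!drsubmx_row'col'.
  rewrite (@drsubmx_mul 1 n A A) => /(canRL (addrK _)).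
  by rewrite -tensmxBl addrK.
rewrite mulmxDl drsubmx_tensmx tensmx_mul mulmx1 BC -drsubmx_row'col'.
rewrite invmx_scalar mul_mx_scalar.
have -> : dlsubmx P *m invmx (1%:M - a *: B) *m ursubmx P *m (1%:M *t C)
    = (1 - a)^-1 *: (dlsubmx T *m ursubmx T).
  have CT : C *m ursubmx T = ursubmx T by rewrite -l12 mulmxA CC.
  rewrite -mulmxA r12 -CT -mulmxA (mulmxA (invmx _)) NC -scalemxAl -scalemxAr.
  by rewrite mulmxA r21 CT.
by rewrite T21 tensmxDl -scalemxAl tensmxZl.
Qed.
End SubmatrixOfTensor.

(** * Maximum principle *)

Section MaximumPrinciple.
Variable R : realType.

(** The maximum principle, the form in which irreducibility is used below: it passes easily to a
    Kronecker factor and yields the invertibility statements. *)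
Definition subharmonic_const n (P : 'M[R]_n) : Prop :=
  forall w : 'cV[R]_n, (forall i, w i 0 <= (P *m w) i 0) -> forall i j, w i 0 = w j 0.

(** Where [w] attains its maximum, it is at most an average of its values at the successors, so
    these are maximal too; connectivity spreads this to every index. *)
Lemma subharmonic_const_irreducible n (P : 'M[R]_n) :
  stochastic P -> irreducible P -> subharmonic_const P.
Proof.
move=> [P0 P1] Pirr w wP i; pose k := [arg max_(k > i) w k 0]%O.
have kmax j : w j 0 <= w k 0.
  by rewrite /k; case: arg_maxP => //= ? _; apply.
have step l l' : w l 0 = w k 0 -> P l l' != 0 -> w l' 0 = w k 0.
  move=> wl Pl; have ge0 j : 0 <= P l j * (w k 0 - w j 0)
    by rewrite mulr_ge0 // subr_ge0.
  have sum0 : \sum_j P l j * (w k 0 - w j 0) = 0.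
    apply: le_anti; apply/andP; split; last first.
      by apply: sumr_ge0 => j _; apply: ge0.
    have -> : \sum_j P l j * (w k 0 - w j 0) = w k 0 - (P *m w) l 0.
      rewrite mxE; under eq_bigr do rewrite mulrBr.
      rewrite sumrB -mulr_suml; congr (_ - _).
      have /matrixP/(_ l 0) := P1; rewrite !mxE.
      by under eq_bigr do rewrite mxE mulr1; move=> ->; rewrite mul1r.
    by rewrite subr_le0 -wl.
  have /eqP : P l l' * (w k 0 - w l' 0) = 0 by exact: (psumr_eq0P (fun j _ => ge0 j) sum0).
  by rewrite mulf_eq0 (negbTE Pl) /= subr_eq0 => /eqP->.
have all_max j : w j 0 = w k 0.
  have /connectP[p pth ->] := Pirr k j.
  have along k' : w k' 0 = w k 0 -> path [rel k l | P k l != 0] k' p ->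
      w (last k' p) 0 = w k 0.
    elim: p k' {pth} => //= l p IH k' wk' /andP[Pl]; apply: IH; exact: step wk' Pl.
  exact: along pth.
by move=> j; rewrite !all_max.
Qed.

(** If [w] is subharmonic for [A], then w *t ones is subharmonic for A *t B. *)
Lemma subharmonic_const_tensl n m (A : 'M[R]_n) (B : 'M[R]_m.+1) :
  B *m ones = ones -> subharmonic_const (A *t B) -> subharmonic_const A.
Proof.
move=> B1 AB w wA i j.
have tE (v : 'cV[R]_n) k l z : (v *t (ones : 'cV_m.+1)) (mxtens_index (k, l)) z = v k 0.
  by rewrite !mxE mxtens_indexK mulr1; congr (v _ _); exact: ord1.
rewrite -(tE w i 0 0) -(tE w j 0 0); apply: AB => k.
rewrite [_ *m _](tensmx_mul A B w ones) B1; case: (mxtens_indexP k) => k1 k2.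
by rewrite !tE.
Qed.

(** The vector of absolute values is subharmonic: by the triangle inequality where [u] is nonzero,
    trivially elsewhere. It is therefore constant, with value 0 at [k]. *)
Lemma subharmonic_fixed_off0 n (P : 'M[R]_n) (u : 'cV[R]_n) (k : 'I_n) :
  (forall i j, 0 <= P i j) -> subharmonic_const P ->
  (forall i, u i 0 != 0 -> (P *m u) i 0 = u i 0) -> u k 0 = 0 -> u = 0.
Proof.
move=> P0 Pc Pu uk; pose w : 'cV_n := \col_i `|u i 0|.
apply/matrixP => i j; rewrite ord1 [RHS]mxE; apply/normr0_eq0.
have : w i 0 = w k 0.
  apply: Pc => l; rewrite !mxE.
  have [->|ul] := eqVneq (u l 0) 0.
    by rewrite normr0; apply: sumr_ge0 => j' _; rewrite mxE mulr_ge0.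
  rewrite -Pu // mxE; apply: le_trans (ler_norm_sum _ _ _) _.
  by apply: ler_sum => j' _; rewrite normrM ger0_norm // mxE.
by rewrite !mxE uk normr0.
Qed.

(** A kernel vector, extended by zero to the other block, is fixed by P wherever it is nonzero and
    vanishes somewhere. *)
Lemma unitmx_sub_ulsubmx p q (P : 'M[R]_(p + q)) : (0 < q)%N ->
  (forall i j, 0 <= P i j) -> subharmonic_const P -> 1%:M - ulsubmx P \in unitmx.
Proof.
case: q P => // q P _ P0 Pc; apply: unitmx_ker0 => u.
rewrite mulmxBl mul1mx => /eqP; rewrite subr_eq0 eq_sym => /eqP Pu.
suff /eqP : col_mx u (0 : 'cV_q.+1) = 0 by rewrite col_mx_eq0 => /andP[/eqP].
apply: (subharmonic_fixed_off0 (k := rshift p 0)) Pc _ _ => //; last by rewrite col_mxEd mxE.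
move=> i; rewrite -[P]submxK mul_block_col !mulmx0 !addr0 Pu.
by case: (split_ordP i) => j ->; rewrite ?col_mxEu // !col_mxEd mxE eqxx.
Qed.

Lemma unitmx_sub_drsubmx p q (P : 'M[R]_(p + q)) : (0 < p)%N ->
  (forall i j, 0 <= P i j) -> subharmonic_const P -> 1%:M - drsubmx P \in unitmx.
Proof.
case: p P => // p P _ P0 Pc; apply: unitmx_ker0 => u.
rewrite mulmxBl mul1mx => /eqP; rewrite subr_eq0 eq_sym => /eqP Pu.
suff /eqP : col_mx (0 : 'cV_p.+1) u = 0 by rewrite col_mx_eq0 => /andP[_ /eqP].
apply: (subharmonic_fixed_off0 (k := lshift q 0)) Pc _ _ => //; last by rewrite col_mxEu mxE.
move=> i; rewrite -[P]submxK mul_block_col !mulmx0 !add0r Pu.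
by case: (split_ordP i) => j ->; rewrite ?col_mxEd // !col_mxEu mxE eqxx.
Qed.

Lemma subharmonic_fixed n (P : 'M[R]_n) (u : 'cV[R]_n) (i : 'I_n) :
  subharmonic_const P -> P *m u = u -> u = u i 0 *: ones.
Proof.
by move=> Pc Pu; apply/matrixP => j k; rewrite ord1 !mxE mulr1; apply: Pc => l; rewrite Pu.
Qed.

(** Applying [v] to a kernel vector [u] gives v u = 0, hence P u = u. So [u] is constant, and v u =
    0 makes the constant 0. *)
Lemma unitmx_fundamental n (P : 'M[R]_n) (v : 'rV[R]_n) :
  subharmonic_const P -> v *m P = v -> v *m ones = 1%:M ->
  1%:M - (P - ones *m v) \in unitmx.
Proof.
move=> Pc vP v1; apply: unitmx_ker0 => u Mu.
have vu : v *m u = 0.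
  have := congr1 (mulmx v) Mu; rewrite mulmx0 mulmxA mulmxBr mulmxBr mulmx1 vP.
  by rewrite mulmxA v1 mul1mx subrr subr0 => ->.
have Pu : P *m u = u.
  move: Mu; rewrite !mulmxBl mul1mx -mulmxA vu mulmx0 subr0 => /eqP.
  by rewrite subr_eq0 => /eqP.
apply/matrixP => i j; rewrite ord1 [RHS]mxE.
have := vu; rewrite (subharmonic_fixed i Pc Pu) -scalemxAr v1 => /matrixP/(_ 0 0).
by rewrite !mxE eqxx !mulr1.
Qed.

(** Nonnegativity is not part of [stationary]. Entrywise |v| <= |v| P, with equal total mass, so |v|
    is fixed; it is then a multiple c v, with c >= 1. *)
Lemma stationary_ge0 n (P : 'M[R]_n) (v : 'rV[R]_n) i :
  stochastic P -> v *m P = v -> v *m ones = 1%:M ->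
  1%:M - (P - ones *m v) \in unitmx -> 0 <= v 0 i.
Proof.
move=> [P0 P1] vP v1 Zu; pose z : 'rV_n := \row_j `|v 0 j|.
have zP j : z 0 j <= (z *m P) 0 j.
  rewrite mxE -{1}vP mxE mxE; apply: le_trans (ler_norm_sum _ _ _) _.
  by apply: ler_sum => k _; rewrite normrM mxE (ger0_norm (P0 _ _)).
have sumE (x : 'rV[R]_n) : \sum_j x 0 j = (x *m ones) 0 0.
  by rewrite mxE; apply: eq_bigr => j _; rewrite mxE mulr1.
have zPz : z *m P = z.
  apply/matrixP => a j; rewrite ord1; apply/eqP; rewrite -subr_eq0; apply/eqP.
  apply: (psumr_eq0P (P := xpredT) (F := fun j => (z *m P) 0 j - z 0 j)) => // [k _|].
    by rewrite subr_ge0.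
  by rewrite sumrB !sumE -mulmxA P1 subrr.
pose c := (z *m ones) 0 0.
(* The fundamental matrix sends both [z] and c v to c v, and it is invertible. *)
have zc : z = c *: v.
  have : (z - c *: v) *m (1%:M - (P - ones *m v)) = 0.
    have zv : z *m (ones *m v) = c *: v by rewrite mulmxA [z *m _]mx11_scalar mul_scalar_mx.
    have vv : v *m (ones *m v) = v by rewrite mulmxA v1 mul1mx.
    rewrite mulmxBl -scalemxAl !mulmxBr !mulmx1 zPz vP zv vv.
    by rewrite !subKr subrr.
  by move/(canRL (mulmxK Zu)); rewrite mul0mx => /eqP; rewrite subr_eq0 => /eqP.
have c1 : 1 <= c.
  have -> : 1 = (v *m ones) 0 0 by rewrite v1 mxE.
  by rewrite /c -!sumE; apply: ler_sum => j _; rewrite mxE ler_norm.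
have : 0 <= c * v 0 i by have := congr1 (fun x : 'rV_n => x 0 i) zc; rewrite !mxE => <-.
by rewrite pmulr_rge0 // (lt_le_trans ltr01).
Qed.

End MaximumPrinciple.

(** * Deflation *)

Section Main.
Variable R : realType.

Lemma stochastic_tens n m (A : 'M[R]_n) (B : 'M[R]_m) :
  stochastic A -> stochastic B -> stochastic (A *t B).
Proof.
move=> [A0 A1] [B0 B1]; split=> [i j|]; first by rewrite mxE mulr_ge0.
have -> : ones = (ones : 'cV[R]_n) *t (ones : 'cV[R]_m) :> 'cV_(n * m).
  by apply/matrixP=> i j; rewrite !mxE mulr1.
by rewrite [LHS](tensmx_mul A B ones ones) A1 B1.
Qed.

(** From u = P (1 - E) u and commutation, E u = P E (1 - E) u = 0, so the deflation does not affect
    [u]. *)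
Lemma fixed_deflated n (P E : 'M[R]_n) (u : 'cV[R]_n) :
  E *m E = E -> P *m E = E *m P -> (1%:M - P *m (1%:M - E)) *m u = 0 ->
  E *m u = 0 /\ (1%:M - P) *m u = 0.
Proof.
move=> EE PE; rewrite mulmxBl mul1mx => /eqP; rewrite subr_eq0 => /eqP uE.
have Eu : E *m u = 0.
  by rewrite uE mulmxA mulmxA -PE -(mulmxA P) mulmxBr mulmx1 EE subrr mulmx0 mul0mx.
split=> //; rewrite mulmxBl mul1mx {1}uE -mulmxA mulmxBl mul1mx Eu subr0.
by rewrite subrr.
Qed.

Lemma unitmx_deflated n (P E : 'M[R]_n) :
  E *m E = E -> P *m E = E *m P -> 1%:M - P \in unitmx ->
  1%:M - P *m (1%:M - E) \in unitmx.
Proof.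
move=> EE PE Pu; apply: unitmx_ker0 => u /(fixed_deflated EE PE)[_ Pu0].
by rewrite -[u](mulKmx Pu) Pu0 mulmx0.
Qed.

(** Deflating [Q] by the rank-one matrix (ones *t ones)(w *t v) splits it into Q (1 - E) and (M -
    ones w) *t C, to which [resolvent_tens] applies. It serves for P with [A], and for P2 with the
    complement in [A]. *)
Lemma kemeny_tens k m (Q : 'M[R]_(k * m)) (M : 'M[R]_k) (C : 'M[R]_m)
    (w : 'rV[R]_k) (v : 'rV[R]_m) :
  let E := 1%:M *t C in
  C = ones *m v -> v *m ones = 1%:M -> M *m ones = ones -> w *m ones = 1%:M ->
  Q *m E = M *t C -> E *m Q = M *t C -> Q *m (ones *t ones : 'cV_(k * m)) = ones *t ones ->
  1%:M - Q *m (1%:M - E) \in unitmx -> 1%:M - (M - ones *m w) \in unitmx ->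
  kemeny Q = (\tr (invmx (1%:M - Q *m (1%:M - E)))
              + \tr (invmx (1%:M - (M - ones *m w))) - k%:R - 1)%:C%C.
Proof.
move=> E CE v1 M1 w1 QE EQ Q1 Qu Mu.
have CC : C *m C = C by rewrite CE -mulmxA (mulmxA v) v1 mul1mx.
have trC : \tr C = 1 by rewrite CE mxtrace_mulC v1 mxtrace1.
have EE : E *m E = E by rewrite tensmx_mul mulmx1 CC.
have QF : Q *m (1%:M - E) = Q - M *t C by rewrite mulmxBr mulmx1 QE.
have r1 : Q *m (1%:M - E) *m E = 0 by rewrite -mulmxA mulmxBl mul1mx EE subrr mulmx0.
have r2 : E *m (Q *m (1%:M - E)) = 0.
  by rewrite mulmxA EQ mulmxBr mulmx1 tensmx_mul mulmx1 CC subrr.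
have [uu trE] := resolvent_tens CC trC r1 r2 Qu Mu.
have sE : Q *m (1%:M - E) + (M - ones *m w) *t C
    = Q - (ones *t ones : 'cV_(k * m)) *m (w *t v : 'rV_(k * m)).
  rewrite QF tensmxBl addrA subrK CE; congr (_ - _).
  by rewrite [RHS](tensmx_mul ones ones w v).
rewrite (kemeny_tr (u := ones *t ones) (v := w *t v)) -?sE ?trE //.
rewrite [LHS](tensmx_mul w v ones ones) w1 v1.
by rewrite [LHS]tens1mx1.
Qed.

End Main.

(** * Assembling the trace identities for P, P1 and P2 *)

Local Open Scope complex_scope.

Theorem proposition4p7 (R : realType) (n m : nat)
    (A : 'M[R]_n.+2) (B : 'M[R]_m) (x : 'cV[R]_n.+2) (y : 'cV[R]_m) :
  stochastic A -> stochastic B ->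
  irreducible (A *t B) ->
  stationary A x -> stationary B y ->
  let P : 'M[R]_(m + n.+1 * m) := A *t B in
  let P11 := ulsubmx P in
  let P12 := ursubmx P in
  let P21 := dlsubmx P in
  let P22 := drsubmx P in
  let P1 := P11 + P12 *m invmx (1%:M - P22) *m P21 in
  let P2 := P22 + P21 *m invmx (1%:M - P11) *m P12 in
  let e1 : 'cV[R]_n.+2 := delta_mx 0 0 in
  let x1 := x 0 0 in
  kemeny P = kemeny P1 + kemeny P2 +
    ((1 - x1)^-1 *
     ((e1^T *m invmx (1%:M - A + ones *m x^T) *m e1) 0 0 - x1))%:C.
Proof.
move=> Ast Bst ABirr [xA x1] [yB y1] P P11 P12 P21 P22 P1 P2 e1 a.
(* For m = 0 the normalization of [y] would read 0 = 1. *)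
case: m => [|m] in B y P P11 P12 P21 P22 P1 P2 Bst ABirr yB y1 *.
  have /matrixP/(_ 0 0) := y1; rewrite !mxE big_ord0 eqxx => /eqP.
  by rewrite eq_sym oner_eq0.
have [A0 A1] := Ast; have [B0 B1] := Bst.
have [P0 Pones] := stochastic_tens Ast Bst.
have Psub : subharmonic_const P by apply: subharmonic_const_irreducible.
have Asub : subharmonic_const A by exact: (@subharmonic_const_tensl R n.+2 m A B).
pose C : 'M[R]_m.+1 := ones *m y^T.
have CC : C *m C = C by rewrite /C -mulmxA (mulmxA y^T) y1 mul1mx.
have BC : B *m C = C by rewrite /C mulmxA B1.
have CB : C *m B = C by rewrite /C -mulmxA yB.
have C1 : C *m ones = ones by rewrite /C -mulmxA y1 mulmx1.
have ulu : 1%:M - ulsubmx P \in unitmx by apply: unitmx_sub_ulsubmx.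
have dru : 1%:M - drsubmx P \in unitmx by apply: unitmx_sub_drsubmx.
have Aulu : 1%:M - ulsubmx (A : 'M_(1 + n.+1)) \in unitmx by apply: unitmx_sub_ulsubmx.
have Zu : 1%:M - (A - ones *m x^T) \in unitmx by apply: unitmx_fundamental.
pose E : 'M[R]_(m.+1 + n.+1 * m.+1) := (1%:M : 'M_n.+2) *t C.
pose E2 : 'M[R]_(n.+1 * m.+1) := 1%:M *t C.
have EB : E = block_mx C 0 0 E2 by exact: tens1_block.
have EE : E *m E = E.
  by rewrite [LHS](tensmx_mul (1%:M : 'M_n.+2) C (1%:M : 'M_n.+2) C) mulmx1 CC.
have PE : P *m E = A *t C by rewrite [LHS](tensmx_mul A B (1%:M : 'M_n.+2) C) mulmx1 BC.
have EP : E *m P = A *t C by rewrite [LHS](tensmx_mul (1%:M : 'M_n.+2) C A B) mul1mx CB.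
have comm : P *m E = E *m P by rewrite PE EP.
have ones_tens k : ones = (ones : 'cV[R]_k) *t (ones : 'cV[R]_m.+1) :> 'cV_(k * m.+1).
  by apply/matrixP=> i j; rewrite !mxE mulr1.
have Eones : E *m ones = ones.
  by rewrite (ones_tens n.+2) [LHS](tensmx_mul (1%:M : 'M_n.+2) C ones ones) mul1mx C1.
(* Here 1 - P is singular, so [unitmx_deflated] does not apply. Instead a kernel vector is fixed by
   P, hence constant; [E] fixes constants but kills this vector. *)
have Pu' : 1%:M - P *m (1%:M - E) \in unitmx.
  apply: unitmx_ker0 => u /(fixed_deflated EE comm)[Eu Pu].
  have {}Pu : P *m u = u.
    by apply/esym/eqP; rewrite -subr_eq0 -{1}[u]mul1mx -mulmxBl Pu.
  have uc := subharmonic_fixed (lshift _ 0) Psub Pu.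
  by rewrite uc -Eones scalemxAr -uc Eu.
have commB : P *m block_mx C 0 0 E2 = block_mx C 0 0 E2 *m P by rewrite -EB.
have [c11 c22] : ulsubmx P *m C = C *m ulsubmx P /\ drsubmx P *m E2 = E2 *m drsubmx P.
  move: commB; rewrite -{1 2}[P]submxK !mulmx_block !mulmx0 !mul0mx !add0r !addr0.
  by case/eq_block_mx.
have EE2 : E2 *m E2 = E2 by rewrite tensmx_mul mulmx1 CC.
have ulu' := unitmx_deflated CC c11 ulu.
have dru' := unitmx_deflated EE2 c22 dru.
have DB : block_mx (1%:M - C) 0 0 (1%:M - E2) = 1%:M - E.
  by rewrite EB scalar_mx_block opp_block_mx add_block_mx !oppr0 !addr0.
have P'B : P *m (1%:M - E) =
    block_mx (ulsubmx P *m (1%:M - C)) (ursubmx P *m (1%:M - E2))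
             (dlsubmx P *m (1%:M - C)) (drsubmx P *m (1%:M - E2)).
  by rewrite -DB -{1}[P]submxK mulmx_block !mulmx0 !add0r !addr0.
have ulE : ulsubmx (P *m (1%:M - E)) = ulsubmx P *m (1%:M - C) by rewrite P'B block_mxKul.
have drE : drsubmx (P *m (1%:M - E)) = drsubmx P *m (1%:M - E2) by rewrite P'B block_mxKdr.
have [compl1 compl2] : compl_ul (P *m (1%:M - E)) = compl_ul P *m (1%:M - C) /\
                 compl_dr (P *m (1%:M - E)) = compl_dr P *m (1%:M - E2).
  rewrite -DB; apply: compl_proj => //; rewrite DB ?ulE ?drE //.
    by rewrite mulmxBr mulmx1 mulmxBl mul1mx EE subrr subr0.
  by rewrite mulmxBr mulmxBl mulmx1 mul1mx comm.
have [] := compl_resolvent Pu'; rewrite ?ulE ?drE // compl1 compl2 => u1 u2 trE.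
have onesB p q : ones = col_mx ones ones :> 'cV[R]_(p + q) by rewrite col_mx_const.
have P1ones : compl_ul P *m ones = ones.
  by apply: (compl_ul_fixed (u2 := ones)) => //; rewrite -onesB.
have P2ones : compl_dr P *m ones = ones.
  by apply: (compl_dr_fixed (u1 := ones)) => //; rewrite -onesB.
(* Since P1 fixes [ones], P1 C = ones y^T: for P1 the deflation has rank one and the trace formula
   applies directly. *)
have k1 : kemeny P1 = (\tr (invmx (1%:M - compl_ul P *m (1%:M - C))) - 1)%:C.
  have P1E : compl_ul P *m (1%:M - C) = compl_ul P - ones *m y^T.
    by rewrite mulmxBr mulmx1 /C mulmxA P1ones.
  by rewrite P1E; apply: kemeny_tr => //; rewrite -P1E.
have xrow : x^T = row_mx a%:M (rsubmx (x^T : 'rV_(1 + n.+1))).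
  have <- : lsubmx (x^T : 'rV_(1 + n.+1)) = a%:M.
    by rewrite [LHS]mx11_scalar !mxE; congr ((x _ _)%:M); apply: val_inj.
  by rewrite hsubmxK.
have ones1 : (ones : 'cV[R]_n.+2) = col_mx 1%:M (ones : 'cV_n.+1).
  have <- : (ones : 'cV[R]_1) = 1%:M by apply/matrixP=> i j; rewrite !ord1 !mxE.
  exact: onesB 1 n.+1.
(* If [a = 1], nonnegativity forces [x] to be the first basis vector, so [A 0 0 = 1]. *)
have a1 : a != 1.
  apply: contraTN Aulu => /eqP a1; rewrite [ulsubmx _]mx11_scalar.
  have xge0 j : 0 <= x^T 0 j by apply: stationary_ge0 Zu.
  have tail0 j : j != 0 -> x^T 0 j = 0.
    have sum0 : \sum_(j | j != 0) x^T 0 j = 0.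
      have /matrixP/(_ 0 0) := x1; rewrite [LHS]mxE (bigD1 0) //= [RHS]mxE.
      rewrite mxE [ones _ _]mxE mulr1 -/a a1 eqxx => /(canRL (addKr _)).
      rewrite addNr => s0; rewrite -[RHS]s0.
      by apply: eq_bigr => i _; rewrite [ones _ _]mxE mulr1.
    exact: (psumr_eq0P (fun j _ => xge0 j) sum0).
  have A00 : A 0 0 = 1.
    have /matrixP/(_ 0 0) := xA; rewrite [LHS]mxE (bigD1 0) //= big1 => [|j /tail0->].
      by rewrite addr0 mxE -/a a1 mul1r.
    by rewrite mul0r.
  have -> : ulsubmx (A : 'M_(1 + n.+1)) 0 0 = A 0 0.
    by rewrite !mxE; congr (A _ _); apply: val_inj.
  by rewrite A00 subrr unitmxE det0 unitr0.
(* The tail of [x], rescaled to mass 1, deflates the complement of a_11 in [A]. *)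
pose w : 'rV[R]_n.+1 := (1 - a)^-1 *: rsubmx (x^T : 'rV_(1 + n.+1)).
have := @fundamental_compl_dr _ n.+1 A a ones (rsubmx (x^T : 'rV_(1 + n.+1))).
cbv zeta; rewrite -ones1 -xrow -/w => /(_ A1 xA x1 a1 Aulu Zu)[Z2u trZ].
have w1 : w *m ones = 1%:M.
  by apply: normalized_tail a1; rewrite -xrow -ones1.
have A2ones : compl_dr (A : 'M_(1 + n.+1)) *m ones = ones.
  by apply: (compl_dr_fixed (u1 := 1%:M)) => //; rewrite -ones1.
have P2E : compl_dr P *m E2 = compl_dr (A : 'M_(1 + n.+1)) *t C.
  by apply: compl_dr_tens => //; rewrite -ulsubmx_tensmx.
have EP2 : E2 *m compl_dr P = compl_dr (A : 'M_(1 + n.+1)) *t C.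
  by rewrite -(compl_dr_comm ulu commB).
have Pt : P *m ((ones : 'cV_n.+2) *t (ones : 'cV_m.+1)) =
    (ones : 'cV_n.+2) *t (ones : 'cV_m.+1).
  by rewrite -ones_tens.
have P2t : compl_dr P *m ((ones : 'cV_n.+1) *t (ones : 'cV_m.+1)) =
    (ones : 'cV_n.+1) *t (ones : 'cV_m.+1).
  by rewrite -ones_tens.
have k0 := @kemeny_tens R n.+2 m.+1 P A C x^T y^T erefl y1 A1 x1 PE EP Pt Pu' Zu.
have k2 := @kemeny_tens R n.+1 m.+1 (compl_dr P) _ C w y^T erefl y1 A2ones w1
  P2E EP2 P2t u2 Z2u.
rewrite k0 k1 k2.
have -> : (e1^T *m invmx (1%:M - A + ones *m x^T) *m e1) 0 0
    = invmx (1%:M - (A - ones *m x^T)) 0 0.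
  by rewrite /e1 trmx_delta -rowE -colE [LHS]mxE [LHS]mxE opprD opprK addrA.
(* The dimension terms n + 2 and n + 1 differ by one, which balances the single -1 of P against
   those of P1 and P2. *)
rewrite trE trZ -!rmorphD; congr (_%:C); rewrite -natr1.
by ring.
Qed.
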